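(* Let $\ell\in\{1,2\}$ and $k\in\mathbb{K}_N$, and let the forward operator $T_{\ell,k}:L^2(\Omega_0)\to\mathbb{R}^m$ satisfy: (a) for every $\delta>0$ there exists $M_{\ell,k}=M_{\ell,k}(\delta)\in\mathbb{R}$ such that $\|T_{\ell,k}(g)\|_{\Sigma_{\ell,k}}\le\exp(\delta\|g\|^2_{L^2(\Omega_0)}+M_{\ell,k})$ for all $g\in L^2(\Omega_0)$; (b) for every $r>0$ there exists $K_{\ell,k}=K_{\ell,k}(r)>0$ such that $\|T_{\ell,k}(g_1)-T_{\ell,k}(g_2)\|_{\Sigma_{\ell,k}}\le K_{\ell,k}\|g_1-g_2\|_{L^2(\Omega_0)}$ for all $g_1,g_2\in L^2(\Omega_0)$ with $\max\{\|g_1\|_{L^2(\Omega_0)},\|g_2\|_{L^2(\Omega_0)}\}<r$. For given data $f^\epsilon_{\ell,k}\in\mathbb{R}^m$, let $\mu^{f^\epsilon_{\ell,k}}$ be the posterior measure defined by $$\frac{d\mu^{f^\epsilon_{\ell,k}}}{d\mu_{pr}}(g)\propto\exp\left(-\tfrac12\|T_{\ell,k}(g)-f^\epsilon_{\ell,k}\|^2_{\Sigma_{\ell,k}}\right).$$ Then: (i) $\mu^{f^\epsilon_{\ell,k}}$ is a well-defined probability measure on $L^2(\Omega_0)$. (ii) $\mu^{f^\epsilon_{\ell,k}}$ is Lipschitz in the data with respect to the Hellinger metric: for every $r>0$ there exists $C_{\ell,k}=C_{\ell,k}(r)>0$ such that for all $f^\epsilon_{\ell,k},f'^{,\epsilon}_{\ell,k}\in\mathbb{R}^m$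 with $\max\{\|f^\epsilon_{\ell,k}\|_{\Sigma_{\ell,k}},\|f'^{,\epsilon}_{\ell,k}\|_{\Sigma_{\ell,k}}\}<r$, $$d_{Hell}(\mu^{f^\epsilon_{\ell,k}},\mu^{f'^{,\epsilon}_{\ell,k}})\le C_{\ell,k}\,\|f^\epsilon_{\ell,k}-f'^{,\epsilon}_{\ell,k}\|_{\Sigma_{\ell,k}}.$$
   Context: Let $a>0$, $\Omega_0=(-a,a)^2$, $B_R=\{x\in\mathbb{R}^2:|x|<R\}$ with $\Omega_0\subset\subset B_R$. $\Sigma_{\ell,k}$ is the (symmetric positive definite) covariance matrix of the Gaussian noise $\eta_{\ell,k}\sim\mathcal{N}(0,\Sigma_{\ell,k})$ in the model $f^\epsilon_{\ell,k}=T_{\ell,k}(g)+\eta_{\ell,k}$, and $\|v\|_{\Sigma}=\|\Sigma^{-1/2}v\|_2$ for $v\in\mathbb{R}^m$. The prior $\mu_{pr}$ is a Gaussian measure on the separable Hilbert space $L^2(\Omega_0)$. Forward operator: $G_k(x,y)=-\frac{\mathrm i}{4}H_0^{(1)}(k|x-y|)$, $H_0^{(1)}=J_0+\mathrm iY_0$; $\mathbb{K}_N=\{\frac{\pi}{a}t:t\in\mathbb{R},t\ge1\}\cup\{k^*\}$ with $k^*>0$, $0<k^*R<1$. With $m$ a positive integer and $\nu_s=s\pi/m$, for $j=1,\dots,m$ let $\partial B_j=\{R(\cos\theta,\sin\theta):\nu_{2j-2}\le\theta\le\nu_{2j}\}$, $z_{j,\ell}=\lambda_{j,\ell}R(\cos\nu_{2j-1},\sin\nu_{2j-1})$,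 and fix a measurement point $x_j\in\partial B_j$; $r_{j,\ell}=|x_j-z_{j,\ell}|$. Here the $\lambda_{j,\ell}\in\mathbb{R}$ either satisfy $\sqrt2a/R\le|\lambda_{j,\ell}|<1$, or are chosen by the paper's explicit rule: $m\ge10$, $k^*=\frac{\pi}{30a}$, $\lambda_{j,1}=\frac12$; $R=\tau a$ ($\tau\ge6$), $\lambda_{j,2}=\frac12+\frac{\pi}{2kR}$ if $k\ne k^*$; $R=6a$, $\lambda_{j,2}=-\frac32$ if $k=k^*$. Then $T_{\ell,k}(g)=(T_{1,\ell,k}(g),\dots,T_{m,\ell,k}(g))^\top$ with $$T_{j,\ell,k}(g)=Y_0(kr_{j,\ell})\int_{\Omega_0}\operatorname{Re}G_k(x_j,y)g(y)\,\mathrm dy-J_0(kr_{j,\ell})\int_{\Omega_0}\operatorname{Im}G_k(x_j,y)g(y)\,\mathrm dy.$$ Hellinger metric: for probability measures $\mu,\mu'$ on $L^2(\Omega_0)$ absolutely continuous with respect to a common reference measure $\nu$, $$d_{Hell}(\mu,\mu')=\sqrt{\frac12\int_{L^2(\Omega_0)}\left(\sqrt{\frac{d\mu}{d\nu}}-\sqrt{\frac{d\mu'}{d\nu}}\right)^2d\nu}.$$ *)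

(* Defs.v *)
From HB Require Import structures.
From mathcomp Require Import all_boot all_order all_algebra.
From mathcomp Require Import all_classical all_reals all_analysis.
From mathcomp Require Import measurable_realfun complex.

Set Implicit Arguments.
Unset Strict Implicit.
Unset Printing Implicit Defensive.

Import Order.TTheory GRing.Theory Num.Theory.
Import numFieldNormedType.Exports.

Local Open Scope classical_set_scope.
Local Open Scope ring_scope.
Local Open Scope charge_scope.

Section Geometry.
Context {R : realType}.
Implicit Types (a r : R) (p q : R * R).

(* The norm and distance of the plane are Euclidean; the norm that the library
   puts on R * R is the maximum norm. *)
Definition enorm2 p : R := Num.sqrt (p.1 ^+ 2 + p.2 ^+ 2).
Definition edist2 p q : R := enorm2 (p.1 - q.1, p.2 - q.2).

Definition Omega0 a : set (R * R) := `]- a, a[ `*` `]- a, a[.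

Definition disc r : set (R * R) := [set p | enorm2 p < r].

Definition compactly_contained (A B : set (R * R)) : Prop :=
  compact (closure A) /\ closure A `<=` B.

Lemma measurable_Omega0 a : measurable (Omega0 a).
Proof. by apply: measurableX; exact: measurable_itv. Qed.

Definition leb2 := (@lebesgue_measure R \x @lebesgue_measure R)%E.

Definition lebOmega0 a := mrestr leb2 (measurable_Omega0 a).
HB.instance Definition _ a := Measure.on (lebOmega0 a).

End Geometry.

Section Lclass.
Context d (T : measurableType d) (R : realType).
Variables (mu : {measure set T -> \bar R}) (p : R) (p1 : (1 <= p%:E)%E).
Variables (u : T -> R) (hu : u \in Lfun mu p%:E).
Local Notation Q := (@aeEqMfun _ _ _ T (measurableTypeR R) mu).

Let v : T -> measurableTypeR R := u.

Let u_mfun : v \in mfun.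
Proof. by move: hu; rewrite inE => /andP[+ _]; rewrite !inE. Qed.

Let cu : Q := (\pi_Q (mfun_Sub u_mfun))%qT.

Lemma Lclass_ae : (cu : T -> R) = u %[ae mu].
Proof.
have : ae_eq_op mu (repr cu) (mfun_Sub u_mfun).
  by apply/eqmodP; rewrite /cu reprK.
by move/asboolP.
Qed.

Lemma Lclass_fin : finite_norm mu p%:E cu.
Proof.
have mcu : measurable_fun setT (cu : T -> R).
  exact: (@measurable_funPT _ _ _ _ (repr cu)).
have mu' : measurable_fun setT u by move: hu; rewrite inE => /andP[/[!inE]].
have : finite_norm mu p%:E u by move: hu; rewrite inE => /andP[_ /[!inE]].
rewrite /finite_norm unlock.
suff -> : (\int[mu]_x (`|(EFin \o u) x| `^ p) =
           \int[mu]_x (`|(EFin \o cu) x| `^ p))%E by [].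
apply: ge0_ae_eq_integral => //.
- apply: (@measurableT_comp _ _ _ _ _ _ (fun x : \bar R => x `^ p)%E) => //=.
    exact: (measurable_poweR p).
  by do 2 apply: measurableT_comp => //.
- apply: (@measurableT_comp _ _ _ _ _ _ (fun x : \bar R => x `^ p)%E) => //=.
    exact: (measurable_poweR p).
  by do 2 apply: measurableT_comp => //.
- by move=> x _; exact: poweR_ge0.
- by move=> x _; exact: poweR_ge0.
- by move: Lclass_ae; apply: filterS => x /= e _; rewrite e.
Qed.

Definition Lclass : LspaceType mu p1 :=
  LebesgueSpace.Pack
    (LebesgueSpace.Class (isFinLebesgue.Axioms_ _ _ _ _ p1 _ Lclass_fin)).

End Lclass.

(* The space L^2(Omega_0): its elements are classes, modulo equality almost
   everywhere on Omega0, of measurable functions with finite norm. An element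
   coerces to a representative. *)
Definition L2 {R : realType} (a : R) : Type := LspaceType2 (lebOmega0 a).

Definition L2fun {R : realType} (a : R) (g : L2 a) : R * R -> R :=
  aqEqMfun_to_fun (LebesgueSpace.sort g).
Coercion L2fun : L2 >-> Funclass.
HB.instance Definition _ (R : realType) (a : R) := gen_eqMixin (L2 a).
HB.instance Definition _ (R : realType) (a : R) := gen_choiceMixin (L2 a).

Section L2space.
Context {R : realType} (a : R).
Local Notation mu := (lebOmega0 a).

Definition L2norm (u : R * R -> R) : R := fine ('N[mu]_2%:E[EFin \o u])%E.

Lemma L2_Lfun (g : L2 a) : (g : R * R -> R) \in Lfun mu 2%:E.
Proof.
rewrite inE; apply/andP; split; rewrite inE/=.
  exact: (@measurable_funPT _ _ _ _ (repr (LebesgueSpace.sort g))).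
by case: g => g [[]].
Qed.

Let p1 : (1 <= (2 : R)%:E)%E := lee1n 2.

Lemma L2norm_fin (u : R * R -> R) : u \in Lfun mu 2%:E ->
  ((L2norm u)%:E = 'N[mu]_2%:E[EFin \o u])%E.
Proof.
move=> hu; exact: (@finite_norm_fine _ _ _ mu _ p1 (Lfun_Sub p1 hu)).
Qed.

Lemma L2norm_triangle (u v : R * R -> R) :
  u \in Lfun mu 2%:E -> v \in Lfun mu 2%:E ->
  L2norm (u \+ v) <= L2norm u + L2norm v.
Proof.
move=> hu hv.
exact: (@ler_LnormD _ _ _ mu _ p1 (Lfun_Sub p1 hu) (Lfun_Sub p1 hv)).
Qed.

Definition L2dist (g h : L2 a) : R := L2norm (g \- h).

Lemma Lfun_sub (g h : L2 a) : (g \- h : R * R -> R) \in Lfun mu 2%:E.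
Proof.
have := Lfun_addr_closed mu p1.
case=> _ /(_ g (- (h : R * R -> R))); apply; first exact: L2_Lfun.
exact: Lfun_oppr_closed (L2_Lfun h).
Qed.

Lemma L2distxx g : L2dist g g = 0.
Proof.
rewrite /L2dist /L2norm.
rewrite (_ : EFin \o _ = cst 0%E); first by rewrite Lnorm0.
by apply/funext => x /=; rewrite subrr.
Qed.

Lemma L2dist_sym g h : L2dist g h = L2dist h g.
Proof.
rewrite /L2dist /L2norm -oppe_Lnorm; congr (fine (Lnorm _ _ _)).
apply/funext => x /=; by congr EFin; rewrite opprB.
Qed.

Lemma L2dist_triangle g f h : L2dist f h <= L2dist f g + L2dist g h.
Proof.
rewrite /L2dist (_ : f \- h = (f \- g) \+ (g \- h)).
  by apply: L2norm_triangle; exact: Lfun_sub.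
by apply/funext => x /=; rewrite addrA subrK.
Qed.

Lemma L2dist_positivity g h : L2dist g h = 0 -> g = h.
Proof.
move=> gh0; have gh : ((g : R * R -> R) = h %[ae mu]).
  have := @fine_Lnormr_eq0 _ _ _ mu _ p1 (Lfun_Sub p1 (Lfun_sub g h)) gh0.
  by apply: filterS => x /= e /e /= /eqP; rewrite subr_eq0 => /eqP.
case: g h gh {gh0} => [g [[cg]]] [h [[ch]]] gh.
have {}gh : g = h.
  rewrite -[g]reprK -[h]reprK; apply/eqmodP; exact/asboolP.
rewrite {}gh in cg *; congr LebesgueSpace.Pack; congr LebesgueSpace.Class.
by congr isFinLebesgue.Axioms_; exact: Prop_irrelevance.
Qed.

HB.instance Definition _ := @isMetric.Build R (L2 a) L2dist
  L2distxx L2dist_positivity L2dist_sym L2dist_triangle.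

Lemma Lfun0 : (cst 0 : R * R -> R) \in Lfun mu 2%:E.
Proof. by case: (Lfun_addr_closed mu p1). Qed.

HB.instance Definition _ := isPointed.Build (L2 a) (Lclass p1 Lfun0).
(* The Borel sigma-algebra of the norm topology. *)
HB.instance Definition _ :=
  Measurable.copy (L2 a) (g_sigma_algebraType (@open (L2 a))).

End L2space.

Section Forward.
Context {R : realType}.
Implicit Types (a r k t : R) (p q : R * R).

(* Power series of the Bessel functions of order zero (DLMF 10.2.2, 10.8.2);
   series harmonic n is the n-th harmonic number. Y0 is meant for t > 0. *)
Definition J0 t : R :=
  limn (series (fun n => (-1) ^+ n * (t / 2) ^+ n.*2 / n`!%:R ^+ 2)).

Definition euler_gamma : R :=
  limn (fun n => series (@harmonic R) n - ln n%:R).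

Definition Y0 t : R :=
  2 / pi * (ln (t / 2) + euler_gamma) * J0 t +
  2 / pi * limn (series (fun n =>
    (-1) ^+ n.+1 * series (@harmonic R) n * (t / 2) ^+ n.*2 / n`!%:R ^+ 2)).

Definition hankel1_0 t : R[i] := (J0 t +i* Y0 t)%C.

Definition green k p q : R[i] :=
  - ('i / 4%:R) * hankel1_0 (k * edist2 p q).

Definition wavenumbers a kstar : set R :=
  [set pi / a * t | t in [set t | 1 <= t]] `|` [set kstar].

Definition nu (m s : nat) : R := s%:R * pi / m%:R.

Definition circle_point r t : R * R := (r * cos t, r * sin t).

(* The index j : 'I_m stands for the index j + 1 of the mathematics, so that
   nu_{2j-2}, nu_{2j-1}, nu_{2j} become nu_{2j}, nu_{2j+1}, nu_{2j+2}. *)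
Definition boundary_arc m r (j : 'I_m) : set (R * R) :=
  [set circle_point r t | t in `[nu m j.*2, nu m j.*2.+2]].

Definition source m r (c : R) (j : 'I_m) : R * R :=
  circle_point (c * r) (nu m j.*2.+1).

(* The radius of the disc may depend on the wavenumber, and lam k j l is
   lambda_{j,l} at the wavenumber k. *)
Definition admissible_lambda m a (kstar : R) (rad : R -> R)
    (lam : R -> 'I_m -> nat -> R) : Prop :=
  forall k j l, wavenumbers a kstar k -> l = 1%N \/ l = 2%N ->
    Num.sqrt 2 * a / rad k <= `|lam k j l| < 1.

Definition explicit_lambda m a (kstar : R) (rad : R -> R)
    (lam : R -> 'I_m -> nat -> R) : Prop :=
  [/\ (10 <= m)%N, kstar = pi / (30 * a) &
   forall k, wavenumbers a kstar k ->
   [/\ forall j, lam k j 1%N = 1 / 2,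
       k <> kstar ->
         (exists2 tau, 6 <= tau & rad k = tau * a) /\
         forall j, lam k j 2%N = 1 / 2 + pi / (2 * k * rad k) &
       k = kstar ->
         rad k = 6 * a /\ forall j, lam k j 2%N = - (3 / 2)]].

(* T_{l,k} for the measurement points x_j and the source points z_j = z_{j,l}. *)
Definition forward a m k (x z : 'I_m -> R * R) (g : L2 a) : 'cV[R]_m :=
  \col_j
    (Y0 (k * edist2 (x j) (z j)) *
       (\int[leb2]_(y in Omega0 a) (complex.Re (green k (x j) y) * g y)) -
     J0 (k * edist2 (x j) (z j)) *
       (\int[leb2]_(y in Omega0 a) (complex.Im (green k (x j) y) * g y))).

End Forward.

Section CovarianceNorm.
Context {R : realType} {m : nat}.

Definition posdefmx (S : 'M[R]_m) : Prop :=
  S^T = S /\ forall v : 'cV[R]_m, v != 0 -> 0 < (v^T *m S *m v) 0 0.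

(* The symmetric positive definite square root, which exists and is unique when
   S is symmetric positive definite. *)
Definition sqrtmx (S : 'M[R]_m) : 'M[R]_m :=
  xget 0 [set Q | posdefmx Q /\ Q *m Q = S].

Definition euclid_norm (v : 'cV[R]_m) : R := Num.sqrt (\sum_i v i 0 ^+ 2).

Definition cov_norm (S : 'M[R]_m) (v : 'cV[R]_m) : R :=
  euclid_norm (invmx (sqrtmx S) *m v).

End CovarianceNorm.

Definition L2inner {R : realType} {a : R} (g h : L2 a) : R :=
  \int[leb2]_(y in Omega0 a) (g y * h y).

(* Every functional <., h> is normally distributed, with a Dirac mass when the
   variance is zero (normal_prob m 0 is not a Dirac mass). *)
Definition gaussian_measure {R : realType} {a : R}
    (mu : probability (L2 a) R) : Prop :=
  forall h : L2 a, exists m s : R, 0 <= s /\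
    forall A : set R, measurable A ->
      mu ((fun g => L2inner g h) @^-1` A) =
      if s == 0 then (\d_m A)%E else normal_prob m s A.

Section Posterior.
Context {R : realType} {a : R} {m : nat}.

Definition likelihood (T : L2 a -> 'cV[R]_m) (S : 'M[R]_m) (f : 'cV[R]_m)
    (g : L2 a) : R :=
  expR (- (1 / 2) * cov_norm S (T g - f) ^+ 2).

Definition is_posterior (T : L2 a -> 'cV[R]_m) (S : 'M[R]_m)
    (mu_pr : probability (L2 a) R) (f : 'cV[R]_m)
    (mu : probability (L2 a) R) : Prop :=
  mu `<< mu_pr /\
  exists2 c : R, 0 < c &
    ae_eq mu_pr setT ('d (charge_of_finite_measure mu) '/d mu_pr)
      (fun g => (c * likelihood T S f g)%:E).

End Posterior.

(* Hellinger distance computed with the reference measure ref, which has to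
   dominate mu and mu'. *)
Definition hellinger d (T : measurableType d) (R : realType)
    (ref : {sigma_finite_measure set T -> \bar R})
    (mu mu' : probability T R) : \bar R :=
  let density (P : probability T R) g :=
    fine (('d (charge_of_finite_measure P) '/d ref) g) in
  sqrte ((1 / 2)%:E * \int[ref]_g
    ((Num.sqrt (density mu g) - Num.sqrt (density mu' g)) ^+ 2)%:E)%E.

(* Main.v *)
Require Import Defs.
From HB Require Import structures.
From mathcomp Require Import all_boot all_order all_algebra.
From mathcomp Require Import all_classical all_reals all_analysis.
From mathcomp Require Import measurable_realfun complex.
From mathcomp Require Import ring lra.

Set Implicit Arguments.
Unset Strict Implicit.
Unset Printing Implicit Defensive.

Import Order.TTheory GRing.Theory Num.Theory.
Import numFieldNormedType.Exports.

Local Open Scope classical_set_scope.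
Local Open Scope ring_scope.

(** The posterior has density proportional to the likelihood
    exp (- s_f^2 / 2), where s_f g = |T g - f| in the covariance seminorm.
    Local Lipschitz continuity of T makes s_f continuous, hence Borel
    (measurable_misfit). The likelihood takes values in ]0, 1], so its integral
    Z_f against the prior is finite and positive, and the posterior is the
    probability measure of density exp (- s_f^2 / 2) / Z_f; integrating over the
    whole space forces the constant of proportionality to be 1 / Z_f, whence
    uniqueness (posteriorP, posterior_exists_unique).

    For the Hellinger estimate, the likelihood is positive, so every measure
    dominating a posterior dominates the prior, and the distance can be
    computed with the prior as reference measure (hellinger_density): it
    compares the roots exp (- s_f^2 / 4) / sqrt Z_f. The map
    s |-> exp (- s^2 / 4) is 1-Lipschitz on the nonnegative reals
    (root_weight_lipschitz) and |s_f - s_f'| <= |f - f'|, so numerators differ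
    by at most |f - f'| and the constants Z_f by at most 2 |f - f'|, uniformly
    in g. Finally s_f^2 <= 2 s_0^2 + 2 |f|^2 bounds Z_f below by
    exp (- r^2) times the integral of exp (- s_0^2) when |f| < r
    (evidence_lower_bound). The roots of the two densities thus differ
    uniformly by at most a constant times |f - f'|, and integrating against a
    probability measure preserves this bound. *)

(** * The covariance seminorm *)

Section CovarianceSeminorm.
Context {R : realType} {m : nat}.
Implicit Types (u v : 'cV[R]_m) (S : 'M[R]_m).

(** With B the sum of the squares of b and s the inner sum, expanding the
    nonnegative sum of the (B a_i - s b_i)^2 gives B (A B - s^2). *)
Lemma Cauchy_Schwarz_sum (I : finType) (a b : I -> R) :
  (\sum_i a i * b i) ^+ 2 <= (\sum_i a i ^+ 2) * (\sum_i b i ^+ 2).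
Proof.
set s := \sum_i a i * b i; set A := \sum_i a i ^+ 2; set B := \sum_i b i ^+ 2.
have B0 : 0 <= B by apply: sumr_ge0 => i _; exact: sqr_ge0.
have [B_eq0|Bneq0] := eqVneq B 0.
  have b0 i : b i = 0.
    have := psumr_eq0P (fun i _ => sqr_ge0 (b i)) B_eq0 => /(_ i isT) /eqP.
    by rewrite sqrf_eq0 => /eqP.
  by rewrite /s big1 ?expr0n ?B_eq0 ?mulr0// => i _; rewrite b0 mulr0.
have Bgt0 : 0 < B by rewrite lt_def Bneq0.
suff : 0 <= B * (A * B - s ^+ 2) by rewrite pmulr_rge0// subr_ge0.
have -> : B * (A * B - s ^+ 2) = \sum_i (B * a i - s * b i) ^+ 2.
  transitivity (\sum_i (B ^+ 2 * a i ^+ 2 - 2 * B * s * (a i * b i)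
                        + s ^+ 2 * b i ^+ 2)); last first.
    by apply: eq_bigr => i _; ring.
  by rewrite big_split sumrB /= -!mulr_sumr -/A -/B -/s; ring.
by apply: sumr_ge0 => i _; exact: sqr_ge0.
Qed.

Lemma euclid_normD u v : euclid_norm (u + v) <= euclid_norm u + euclid_norm v.
Proof.
have s0 (w : 'cV[R]_m) : 0 <= \sum_i w i 0 ^+ 2.
  by apply: sumr_ge0 => i _; exact: sqr_ge0.
rewrite /euclid_norm -[leRHS]ger0_norm ?addr_ge0 ?sqrtr_ge0//.
rewrite -sqrtr_sqr ler_sqrt ?sqr_ge0//.
rewrite sqrrD !sqr_sqrtr//.
have -> : \sum_i (u + v) i 0 ^+ 2 =
    \sum_i u i 0 ^+ 2 + (\sum_i u i 0 * v i 0) *+ 2 + \sum_i v i 0 ^+ 2.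
  rewrite -sumrMnl -!big_split /=.
  by apply: eq_bigr => i _; rewrite mxE sqrrD.
rewrite lerD2r lerD2l lerMn2r /= -sqrtrM//.
apply: (le_trans (ler_norm _)); rewrite -sqrtr_sqr ler_sqrt ?mulr_ge0//.
exact: Cauchy_Schwarz_sum.
Qed.

Lemma cov_norm_ge0 S v : 0 <= cov_norm S v.
Proof. exact: sqrtr_ge0. Qed.

Lemma cov_normN S v : cov_norm S (- v) = cov_norm S v.
Proof.
rewrite /cov_norm mulmxN /euclid_norm; congr Num.sqrt.
by apply: eq_bigr => i _; rewrite mxE sqrrN.
Qed.

Lemma cov_normD S u v : cov_norm S (u + v) <= cov_norm S u + cov_norm S v.
Proof. by rewrite /cov_norm mulmxDr; exact: euclid_normD. Qed.

(** This reverse triangle inequality turns a perturbation of the data, or of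
    the parameter, into a perturbation of the misfit. *)
Lemma cov_norm_dist S u v :
  `|cov_norm S u - cov_norm S v| <= cov_norm S (u - v).
Proof.
rewrite ler_norml lerBlDr lerNl opprB lerBlDr; apply/andP; split.
  by rewrite -(cov_normN _ (u - v)) opprB -{1}[v](subrK u) cov_normD.
by rewrite -{1}[u](subrK v) cov_normD.
Qed.

End CovarianceSeminorm.

(** * Square roots of Gaussian weights *)

Section GaussianWeight.
Context {R : realType}.
Implicit Types s t : R.

(** The square root of the weight exp (- s^2 / 2): the Hellinger distance
    compares square roots of densities. *)
Definition root_weight s : R := expR (- (s ^+ 2 / 4)).

Lemma root_weight_gt0 s : 0 < root_weight s.
Proof. exact: expR_gt0. Qed.

Lemma root_weight_le1 s : root_weight s <= 1.
Proof. by rewrite -[leRHS]expR0 ler_expR oppr_le0 divr_ge0// sqr_ge0. Qed.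

Lemma root_weight_sqr s : root_weight s ^+ 2 = expR (- (1 / 2) * s ^+ 2).
Proof. by rewrite -expRM_natl; congr expR; field. Qed.

(** Let s <= t = s + d. If d >= 1, both values lie in [0, 1]. Otherwise
    1 - exp (- u) <= u with u = (s + t) d / 4 reduces the claim to
    exp (- s^2 / 4) (s + t) <= 4, which follows from
    s + t <= 2 s + 1 <= 4 + s^2 <= 4 exp (s^2 / 4). *)
Lemma root_weight_lipschitz s t : 0 <= s -> 0 <= t ->
  `|root_weight s - root_weight t| <= `|s - t|.
Proof.
wlog st : s t / s <= t.
  move=> H s0 t0; have [st|/ltW ts] := leP s t; first exact: H.
  by rewrite distrC [leRHS]distrC; exact: H.
move=> s0 t0; rewrite [leRHS]distrC (ger0_norm (_ : 0 <= t - s)) ?subr_ge0//.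
rewrite ger0_norm; last first.
  rewrite subr_ge0 ler_expR lerN2 ler_pM2r ?invr_gt0//.
  by rewrite ler_pXn2r// nnegrE.
have [ts1|ts1] := leP 1 (t - s).
  apply: le_trans ts1; rewrite lerBlDr.
  by rewrite (le_trans (root_weight_le1 s))// lerDl ltW// root_weight_gt0.
set d := t - s in ts1 *.
have d0 : 0 <= d by rewrite subr_ge0.
have tE : t = s + d by rewrite /d; ring.
have -> : root_weight t = root_weight s * expR (- ((s + t) * d / 4)).
  by rewrite /root_weight -expRD; congr expR; rewrite /d; field.
have e1 := expR_ge1Dx (- ((s + t) * d / 4)).
have e2 : root_weight s * (1 + s ^+ 2 / 4) <= 1.
  rewrite -[leRHS](expRxMexpNx_1 (s ^+ 2 / 4)) mulrC ler_pM2r ?expR_gt0//.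
  exact: expR_ge1Dx.
have p0 := root_weight_gt0 s.
have : root_weight s * (1 - (s + t) * d / 4)
     <= root_weight s * expR (- ((s + t) * d / 4)) by rewrite ler_pM2l.
have : root_weight s * ((s + t) / 4) <= 1.
  by apply: le_trans e2; rewrite ler_pM2l//; nra.
set p := root_weight s in p0 *; set q := (X in _ * X <= _) => h1 h2.
have := ler_wpM2r d0 h1; rewrite mul1r /q; lra.
Qed.

(** The splitting p / q - p' / q' = (p - p') / q + p' (1 / q - 1 / q') with
    q = sqrt Z and q' = sqrt Z' separates the two sources of error. As
    q, q' >= b, dividing Z' - Z = (q' - q) (q + q') by q + q' >= 2 b gives
    |q' - q| <= e / b, and 1 / q - 1 / q' = (q' - q) / (q q') contributes two
    more factors 1 / b. *)
Lemma normalized_root_lipschitz (p p' Z Z' b e : R) :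
  0 < b -> b ^+ 2 <= Z -> b ^+ 2 <= Z' -> 0 < p <= 1 -> 0 < p' <= 1 ->
  `|p - p'| <= e -> `|Z - Z'| <= 2 * e ->
  `|Num.sqrt (Z^-1 * p ^+ 2) - Num.sqrt (Z'^-1 * p' ^+ 2)| <=
  (b^-1 + b^-1 ^+ 3) * e.
Proof.
move=> b0 bZ bZ' /andP[p0 p1] /andP[p0' p1'] pe Ze.
have Z0 : 0 < Z by apply: lt_le_trans bZ; exact: exprn_gt0.
have Z0' : 0 < Z' by apply: lt_le_trans bZ'; exact: exprn_gt0.
have rootE (z y : R) : 0 < z -> 0 < y ->
    Num.sqrt (z^-1 * y ^+ 2) = (Num.sqrt z)^-1 * y.
  move=> z0 y0; rewrite sqrtrM ?invr_ge0 ?ltW// sqrtrV ?ltW// sqrtr_sqr.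
  by rewrite gtr0_norm.
rewrite !rootE//.
set q := Num.sqrt Z; set q' := Num.sqrt Z'.
have bq : b <= q by rewrite -(ger0_norm (ltW b0)) -sqrtr_sqr ler_sqrt// ltW.
have bq' : b <= q' by rewrite -(ger0_norm (ltW b0)) -sqrtr_sqr ler_sqrt// ltW.
have q0 : 0 < q by exact: lt_le_trans bq.
have q0' : 0 < q' by exact: lt_le_trans bq'.
have e0 : 0 <= e by exact: le_trans pe.
have qb : q^-1 <= b^-1 by rewrite lef_pV2.
have qb' : q'^-1 <= b^-1 by rewrite lef_pV2.
have qq' : `|q' - q| <= b^-1 * e.
  have : `|q' - q| * (q + q') <= 2 * e.
    rewrite -[X in _ * X]gtr0_norm ?addr_gt0// -normrM.
    suff -> : (q' - q) * (q + q') = - (Z - Z') by rewrite normrN.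
    by rewrite -[Z]sqr_sqrtr ?ltW// -[Z']sqr_sqrtr ?ltW// -/q -/q'; ring.
  have : `|q' - q| * (2 * b) <= `|q' - q| * (q + q').
    by rewrite ler_wpM2l// mulrDl !mul1r lerD.
  rewrite ler_pdivlMl//; lra.
have -> : q^-1 * p - q'^-1 * p' =
    q^-1 * (p - p') + (q' - q) * (q^-1 * q'^-1) * p'.
  by field; rewrite !gt_eqF.
rewrite [leRHS]mulrDl; apply: (le_trans (ler_normD _ _)); apply: lerD.
  by rewrite normrM gtr0_norm ?invr_gt0// ler_pM// ltW// invr_gt0.
have iq0 : 0 <= q^-1 by rewrite invr_ge0 ltW.
have iq0' : 0 <= q'^-1 by rewrite invr_ge0 ltW.
rewrite !normrM (gtr0_norm p0') (ger0_norm iq0) (ger0_norm iq0').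
have -> : b^-1 ^+ 3 * e = b^-1 * e * (b^-1 * b^-1) * 1 by ring.
apply: ler_pM => //; [by rewrite !mulr_ge0|exact: ltW|].
by apply: ler_pM => //; [rewrite mulr_ge0|exact: ler_pM].
Qed.

End GaussianWeight.

(** * Densities and the Hellinger distance *)

Section Densities.
Context d (T : measurableType d) (R : realType).
Local Open Scope ereal_scope.
Implicit Types (P mu : probability T R) (h : T -> R).

(** This serves twice: with A = setT it shows that the integral of a positive
    weight does not vanish, and for general A that a positive density gives
    mutual absolute continuity. *)
Lemma integral_gt0_null P h A : measurable A -> measurable_fun setT h ->
  (forall x, 0 < h x)%R -> \int[P]_(x in A) (h x)%:E = 0 -> P A = 0.
Proof.
move=> mA mh h0 hA0.
have mEh : measurable_fun A (EFin \o h).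
  by apply/measurable_EFinP; exact: measurable_funTS.
have : \int[P]_(x in A) `|(EFin \o h) x| = 0.
  by rewrite -hA0; apply: eq_integral => x _ /=; rewrite gtr0_norm.
move/(ae_eq_integral_abs P mA mEh) => [N [mN PN0 AN]].
apply/eqP; rewrite -measure_le0 -PN0; apply: le_measure; rewrite ?inE//.
move=> x Ax; apply: AN => /= /(_ Ax) /eqP; rewrite eqe => /eqP hx0.
by have := h0 x; rewrite hx0 ltxx.
Qed.

(** Unlike a Radon-Nikodym derivative, which is determined almost everywhere,
    this allows computing with the function h itself. *)
Definition has_density P mu h :=
  forall A, measurable A -> mu A = \int[P]_(x in A) (h x)%:E.

Section Existence.
Variables (P : probability T R) (h : T -> R).
Hypotheses (mh : measurable_fun setT h) (h_ge0 : forall x, (0 <= h x)%R).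
Hypothesis h_int1 : \int[P]_x (h x)%:E = 1.

Let density_measure A := \int[P]_(x in A) (h x)%:E.

Let density_measure0 : density_measure set0 = 0.
Proof. by rewrite /density_measure integral_set0. Qed.

Let density_measure_ge0 A : 0 <= density_measure A.
Proof. by apply: integral_ge0 => x _; rewrite lee_fin. Qed.

Let density_measure_sigma_additive : semi_sigma_additive density_measure.
Proof.
move=> /= F mF tF mUF; rewrite /density_measure; apply: cvg_toP.
  apply: ereal_nondecreasing_is_cvgn => m n mn.
  by apply: lee_sum_nneg_natr => // k _ _; exact: density_measure_ge0.
rewrite ge0_integral_bigcup//=.
- by apply/measurable_EFinP; exact: measurable_funTS.
- by move=> x _; rewrite lee_fin.
Qed.

HB.instance Definition _ := isMeasure.Build _ _ _ density_measure
  density_measure0 density_measure_ge0 density_measure_sigma_additive.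

HB.instance Definition _ :=
  @Measure_isProbability.Build _ _ R density_measure h_int1.

Lemma density_probability : exists mu : probability T R, has_density P mu h.
Proof. by exists (density_measure : probability T R). Qed.

End Existence.

Lemma has_density_dominates P mu h : measurable_fun setT h ->
  has_density P mu h -> mu `<< P.
Proof.
move=> mh muh; apply/null_content_dominatesP => A mA PA0.
rewrite muh// null_set_integral//.
by apply/measurable_EFinP; exact: measurable_funTS.
Qed.

Lemma has_density_dominated P mu h : measurable_fun setT h ->
  (forall x, 0 < h x)%R -> has_density P mu h -> P `<< mu.
Proof.
move=> mh h0 muh; apply/null_content_dominatesP => A mA muA0.
by apply: (integral_gt0_null mA mh h0); rewrite -muh.
Qed.

Local Notation RN mu ref := (Radon_Nikodym (charge_of_finite_measure mu) ref).

Lemma has_densityP P mu h : measurable_fun setT h ->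
  has_density P mu h <-> mu `<< P /\ ae_eq P setT (RN mu P) (EFin \o h).
Proof.
move=> mh; have mEh : measurable_fun setT (EFin \o h) by exact/measurable_EFinP.
split=> [muh|[muP RNh] A mA].
  have muP := has_density_dominates mh muh; split => //.
  apply: integral_ae_eq => // [|A _ mA]; first exact: Radon_Nikodym_integrable.
  by rewrite -Radon_Nikodym_integral// -muh.
transitivity (charge_of_finite_measure mu A) => //.
rewrite (@Radon_Nikodym_integral _ _ _ _ P)//.
apply: ae_eq_integral => //; first exact: measurable_funTS.
  exact: measurable_funTS.
exact: ae_eq_subset RNh.
Qed.

Local Notation f P ref := (Radon_Nikodym_SigmaFinite.f P ref).

(** Chain rule through P with the everywhere nonnegative version of dP / dref,
    so that square roots of the product split without exceptional sets. *)
Lemma has_density_chain P mu h (ref : {sigma_finite_measure set T -> \bar R}) :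
  measurable_fun setT h -> (forall x, 0 <= h x)%R ->
  has_density P mu h -> P `<< ref ->
  ae_eq ref setT (RN mu ref) (fun x => (h x)%:E * f P ref x).
Proof.
move=> mh h0 muh Pref.
have muref : mu `<< ref.
  exact: null_dominates_trans (has_density_dominates mh muh) Pref.
have mf := measurable_int _ (Radon_Nikodym_SigmaFinite.f_integrable Pref).
have mEh : measurable_fun setT (EFin \o h) by exact/measurable_EFinP.
apply: integral_ae_eq => //.
- exact: Radon_Nikodym_integrable.
- exact: emeasurable_funM.
- move=> A _ mA; rewrite -Radon_Nikodym_integral//.
  rewrite (@Radon_Nikodym_SigmaFinite.change_of_variables _ _ _ _ _ Pref
    (EFin \o h))//; first by rewrite -muh.
  exact: measurable_funTS.
Qed.

Lemma measurable_sqrt_dist h h' :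
  measurable_fun setT h -> measurable_fun setT h' ->
  measurable_fun setT
    (fun x => ((Num.sqrt (h x) - Num.sqrt (h' x)) ^+ 2)%:E).
Proof.
have msqrt (g : T -> R) : measurable_fun setT g ->
    measurable_fun setT (fun x => Num.sqrt (g x)).
  move=> mg; apply: (measurableT_comp _ mg).
  by apply: continuous_measurable_fun; exact: sqrt_continuous.
move=> mh mh'; apply/measurable_EFinP; apply: measurable_funX.
by apply: measurable_funB; exact: msqrt.
Qed.

(** Independence of the reference measure: the factor dP / dref comes out of
    both square roots, and integrating it against ref is integrating
    against P. *)
Lemma hellinger_density P mu mu' h h'
    (ref : {sigma_finite_measure set T -> \bar R}) :
  measurable_fun setT h -> measurable_fun setT h' ->
  (forall x, 0 <= h x)%R -> (forall x, 0 <= h' x)%R ->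
  has_density P mu h -> has_density P mu' h' -> P `<< ref ->
  hellinger ref mu mu' =
  sqrte ((1 / 2)%:E * \int[P]_x ((Num.sqrt (h x) - Num.sqrt (h' x)) ^+ 2)%:E).
Proof.
move=> mh mh' h0 h0' muh muh' Pref.
have chain := has_density_chain mh h0 muh Pref.
have chain' := has_density_chain mh' h0' muh' Pref.
have muref : mu `<< ref.
  exact: null_dominates_trans (has_density_dominates mh muh) Pref.
have muref' : mu' `<< ref.
  exact: null_dominates_trans (has_density_dominates mh' muh') Pref.
have mf := measurable_int _ (Radon_Nikodym_SigmaFinite.f_integrable Pref).
rewrite /hellinger; congr (sqrte (_ * _)).
have mD := measurable_sqrt_dist mh mh'.
rewrite -(@Radon_Nikodym_SigmaFinite.change_of_variables _ _ _ _ _ Pref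
    (fun x => ((Num.sqrt (h x) - Num.sqrt (h' x)) ^+ 2)%:E))//; last first.
  by move=> x; rewrite lee_fin sqr_ge0.
apply: ae_eq_integral => //.
- apply: measurable_sqrt_dist;
  apply: (measurableT_comp
    (measurable_realfun.fine_measurable measurableT)) => //;
  apply: (measurable_int ref); exact: Radon_Nikodym_integrable.
- exact: emeasurable_funM.
apply: filterS2 chain chain' => x /= /(_ I) -> /(_ I) -> _.
have f0 := Radon_Nikodym_SigmaFinite.f_ge0 Pref x.
have ffin := Radon_Nikodym_SigmaFinite.f_fin_num Pref x.
rewrite -(fineK ffin) -!EFinM /=; congr EFin.
have {f0}f0 : (0 <= fine (f P ref x))%R by exact: fine_ge0.
by rewrite !sqrtrM// -mulrBl exprMn sqr_sqrtr.
Qed.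

End Densities.

(** * Normalizing a bounded weight *)

Section Normalization.
Context d (T : measurableType d) (R : realType) (P : probability T R).
Implicit Types (w : T -> R) (mu : probability T R).

(** The normalizing constant, known as the evidence in Bayesian statistics. *)
Definition evidence w : R := \int[P]_x w x.

Lemma unit_weight_integrable w : measurable_fun setT w ->
  (forall x, 0 < w x <= 1) -> P.-integrable setT (EFin \o w).
Proof.
move=> mw w01.
apply: (le_integrable measurableT _ _
  (finite_measure_integrable_cst P 1 measurableT)).
  exact/measurable_EFinP.
move=> x _ /=; have /andP[w0 w1] := w01 x.
by rewrite lee_fin normr1 gtr0_norm.
Qed.

Lemma evidenceE w : measurable_fun setT w -> (forall x, 0 < w x <= 1) ->
  (\int[P]_x (w x)%:E = (evidence w)%:E)%E.
Proof.
move=> mw w01; rewrite /evidence /Rintegral fineK//.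
by apply: integrable_fin_num => //; exact: unit_weight_integrable.
Qed.

Lemma evidence_gt0 w : measurable_fun setT w -> (forall x, 0 < w x <= 1) ->
  0 < evidence w.
Proof.
move=> mw w01; have w0 x : 0 < w x by case/andP: (w01 x).
rewrite lt_def; apply/andP; split; last first.
  by apply: Rintegral_ge0 => x _; exact: ltW.
apply/eqP => Z0; have := integral_gt0_null (P := P) measurableT mw w0.
rewrite evidenceE// Z0 => /(_ erefl); rewrite probability_setT => /eqP.
by rewrite onee_eq0.
Qed.

Definition normalized w x : R := (evidence w)^-1 * w x.

Lemma measurable_normalized w : measurable_fun setT w ->
  measurable_fun setT (normalized w).
Proof. by move=> mw; apply: measurable_funM. Qed.

Lemma normalized_gt0 w : measurable_fun setT w -> (forall x, 0 < w x <= 1) ->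
  forall x, 0 < normalized w x.
Proof.
move=> mw w01 x; rewrite mulr_gt0 ?invr_gt0 ?evidence_gt0//.
by case/andP: (w01 x).
Qed.

Lemma normalized_probability w : measurable_fun setT w ->
  (forall x, 0 < w x <= 1) -> exists mu, has_density P mu (normalized w).
Proof.
move=> mw w01; apply: density_probability.
- exact: measurable_normalized.
- by move=> x; exact: ltW (normalized_gt0 mw w01 x).
under eq_integral do rewrite EFinM.
rewrite integralZl//; last exact: unit_weight_integrable.
by rewrite evidenceE// -EFinM mulVf// gt_eqF// evidence_gt0.
Qed.

(** The constant of proportionality is forced by total mass 1; this gives
    uniqueness of the posterior. *)
Lemma proportional_densityP w mu : measurable_fun setT w ->
  (forall x, 0 < w x <= 1) ->
  (mu `<< P /\ exists2 c : R, 0 < c &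
    ae_eq P setT (Radon_Nikodym (charge_of_finite_measure mu) P)
      (fun x => (c * w x)%:E)) <->
  has_density P mu (normalized w).
Proof.
move=> mw w01; have Z0 := evidence_gt0 mw w01.
split=> [[muP [c c0 muc]]|]; last first.
  move/(has_densityP P mu (measurable_normalized mw)) => [muP muw].
  by split => //; exists (evidence w)^-1 => //; rewrite invr_gt0.
have mcw : measurable_fun setT (fun x => c * w x) by exact: measurable_funM.
have h : has_density P mu (fun x => c * w x) by apply/has_densityP.
have := h _ measurableT; rewrite probability_setT.
under eq_integral do rewrite EFinM.
rewrite integralZl//; last exact: unit_weight_integrable.
rewrite evidenceE// -EFinM => -[cZ].
suff cE : c = (evidence w)^-1 by rewrite /normalized -cE.
by apply: (mulIf (lt0r_neq0 Z0)); rewrite mulVf ?lt0r_neq0.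
Qed.

End Normalization.

(** * Stability of normalized Gaussian weights *)

Section GaussianPosteriors.
Context d (T : measurableType d) (R : realType) (P : probability T R).
Implicit Types (s : T -> R) (r b e : R) (mu : probability T R).

(** Applied to the data misfit this is the likelihood. *)
Definition gauss s x : R := expR (- (1 / 2) * s x ^+ 2).

Lemma gauss_root s x : gauss s x = root_weight (s x) ^+ 2.
Proof. by rewrite root_weight_sqr. Qed.

Lemma measurable_gauss s : measurable_fun setT s ->
  measurable_fun setT (gauss s).
Proof.
move=> ms; apply: (@measurableT_comp _ _ _ _ _ _ expR _
  (fun x => - (1 / 2) * s x ^+ 2)) => //.
by apply: measurable_funM => //; exact: measurable_funX.
Qed.

Lemma gauss_unit s x : 0 < gauss s x <= 1.
Proof.
rewrite gauss_root exprn_gt0 ?root_weight_gt0//= expr_le1//.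
  exact: root_weight_le1.
exact/ltW/root_weight_gt0.
Qed.

(** From s^2 <= (s0 + r)^2 <= 2 s0^2 + 2 r^2; the bound depends on s only
    through s0 and r, hence is uniform over bounded data. *)
Lemma evidence_lower_bound s s0 r : measurable_fun setT s ->
  measurable_fun setT s0 -> (forall x, 0 <= s x <= s0 x + r) ->
  expR (- r ^+ 2) * evidence P (fun x => expR (- s0 x ^+ 2)) <=
  evidence P (gauss s).
Proof.
move=> ms ms0 ss0.
have m0 : measurable_fun setT (fun x => expR (- s0 x ^+ 2)).
  apply: (@measurableT_comp _ _ _ _ _ _ expR _ (fun x => - s0 x ^+ 2)) => //.
  by apply: measurable_funN => //; exact: measurable_funX.
have i0 : P.-integrable setT (EFin \o (fun x => expR (- s0 x ^+ 2))).
  apply: unit_weight_integrable => // x.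
  by rewrite expR_gt0 -expR0 ler_expR oppr_le0 sqr_ge0.
rewrite /evidence -RintegralZl//; apply: le_Rintegral => //.
- apply: (eq_integrable _ (fun x => (expR (- r ^+ 2))%:E *
    (EFin \o (fun x => expR (- s0 x ^+ 2))) x)%E) => //.
  exact: integrableZl.
- apply: unit_weight_integrable; first exact: measurable_gauss.
  exact: gauss_unit.
move=> x _; rewrite /gauss -expRD ler_expR.
have /andP[sx0 sx] := ss0 x.
have : s x ^+ 2 <= (s0 x + r) ^+ 2 by rewrite ler_pXn2r ?nnegrE//; lra.
have := sqr_ge0 (s0 x - r); nra.
Qed.

(** Factor a difference of weights as (p - p') (p + p') with p, p' <= 1 the
    roots; the first factor is at most e by the Lipschitz bound. *)
Lemma evidence_lipschitz s s' e : measurable_fun setT s ->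
  measurable_fun setT s' -> (forall x, 0 <= s x) -> (forall x, 0 <= s' x) ->
  (forall x, `|s x - s' x| <= e) ->
  `|evidence P (gauss s) - evidence P (gauss s')| <= 2 * e.
Proof.
move=> ms ms' s0 s0' ss'.
have i := unit_weight_integrable P (measurable_gauss ms) (gauss_unit s).
have i' := unit_weight_integrable P (measurable_gauss ms') (gauss_unit s').
rewrite /evidence -RintegralB//.
have iB : P.-integrable setT (EFin \o (fun x => gauss s x - gauss s' x)).
  apply: (eq_integrable _
    ((EFin \o gauss s) \- (EFin \o gauss s'))%E) => //.
  exact: integrableB.
apply: (le_trans (le_normr_Rintegral _ iB)) => //.
have -> : 2 * e = \int[P]_(x in setT) (2 * e).
  by rewrite Rintegral_cst// [fine _](congr1 fine (probability_setT P)) mulr1.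
apply: le_Rintegral => //.
- exact: (integrable_norm iB).
- exact: finite_measure_integrable_cst.
move=> x _; rewrite !gauss_root subr_sqr normrM mulrC.
apply: ler_pM => //.
  rewrite ger0_norm ?addr_ge0 ?(ltW (root_weight_gt0 _))//.
  by rewrite -[2]/(1 + 1) lerD ?root_weight_le1.
exact: le_trans (root_weight_lipschitz (s0 x) (s0' x)) (ss' x).
Qed.

(** The integrand of the Hellinger distance is bounded pointwise by the square
    of the right-hand side, and P has total mass 1. *)
Lemma hellinger_gauss s s' b e mu mu'
    (ref : {sigma_finite_measure set T -> \bar R}) :
  measurable_fun setT s -> measurable_fun setT s' ->
  (forall x, 0 <= s x) -> (forall x, 0 <= s' x) ->
  (forall x, `|s x - s' x| <= e) ->
  0 < b -> b ^+ 2 <= evidence P (gauss s) ->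
  b ^+ 2 <= evidence P (gauss s') ->
  has_density P mu (normalized P (gauss s)) ->
  has_density P mu' (normalized P (gauss s')) -> mu `<< ref ->
  (hellinger ref mu mu' <= ((b^-1 + b^-1 ^+ 3) * e)%:E)%E.
Proof.
move=> ms ms' s0 s0' ss' b0 bZ bZ' muh muh' muref.
have mg := measurable_gauss ms; have mg' := measurable_gauss ms'.
have h0 := normalized_gt0 P mg (gauss_unit s).
have h0' := normalized_gt0 P mg' (gauss_unit s').
have mh := measurable_normalized P mg; have mh' := measurable_normalized P mg'.
have Pref : P `<< ref.
  exact: null_dominates_trans (has_density_dominated mh h0 muh) muref.
rewrite (hellinger_density mh mh' _ _ muh muh' Pref); last 2 first.
- by move=> x; exact: ltW.
- by move=> x; exact: ltW.
have e0 : 0 <= e by exact: le_trans (ss' point).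
set C := (_ + _) * e.
have C0 : 0 <= C by rewrite mulr_ge0// addr_ge0 ?exprn_ge0// invr_ge0 ltW.
have -> : C%:E = sqrte (C ^+ 2)%:E by rewrite /= sqrtr_sqr ger0_norm.
have int_le : (\int[P]_x ((Num.sqrt (normalized P (gauss s) x) -
    Num.sqrt (normalized P (gauss s') x)) ^+ 2)%:E <= (C ^+ 2)%:E)%E.
  rewrite -[leRHS]mule1 -(probability_setT P) -integral_cst//.
  apply: ge0_le_integral => //.
  - by move=> x _; rewrite lee_fin sqr_ge0.
  - exact: measurable_sqrt_dist.
  - move=> x _; rewrite lee_fin -real_normK ?num_real// ler_pXn2r ?nnegrE//.
    rewrite /normalized !gauss_root; apply: normalized_root_lipschitz => //.
    + by rewrite root_weight_gt0 root_weight_le1.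
    + by rewrite root_weight_gt0 root_weight_le1.
    + exact: le_trans (root_weight_lipschitz (s0 x) (s0' x)) (ss' x).
    + exact: evidence_lipschitz.
rewrite lee_sqrt; last by rewrite lee_fin exprn_ge0.
(* The factor 1 / 2 in the distance is bounded by 1. *)
apply: le_trans int_le; rewrite -[leRHS]mul1e lee_wpmul2r//.
  by apply: integral_ge0 => x _; rewrite lee_fin sqr_ge0.
by rewrite lee_fin; lra.
Qed.

End GaussianPosteriors.

(** * Measurability on the space of square-integrable functions *)

Section L2Measurability.
Context {R : realType} (a : R).

Lemma L2norm_le_dist (g h : L2 a) : L2norm a h <= L2norm a g + L2dist g h.
Proof.
rewrite L2dist_sym addrC /L2dist.
rewrite {1}(_ : (h : R * R -> R) = (h \- g) \+ g); last first.
  by apply/funext => y /=; rewrite subrK.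
by apply: L2norm_triangle; [exact: Lfun_sub|exact: L2_Lfun].
Qed.

(** Near g all norms stay below |g| + 1, so a single Lipschitz constant
    applies. *)
Lemma locally_lipschitz_continuous (F : L2 a -> R) :
  (forall r, 0 < r -> exists2 K : R, 0 < K & forall g h : L2 a,
    Num.max (L2norm a g) (L2norm a h) < r ->
    `|F g - F h| <= K * L2dist g h) ->
  continuous F.
Proof.
move=> lipF g; apply/(@cvgrPdist_lt _ _ _ _ (nbhs_filter g)) => e e0.
have [|K K0 FK] := lipF (`|L2norm a g| + 1); first by rewrite ltr_wpDl.
apply/nbhs_ballP; exists (Num.min 1 (e / K)).
  by rewrite /= lt_min ltr01 divr_gt0.
move=> h; rewrite ballEmdist /= lt_min => /andP[gh1 ghe].
apply: (@le_lt_trans _ _ (K * L2dist g h)); last by rewrite mulrC -ltr_pdivlMr.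
apply: FK; rewrite gt_max (le_lt_trans (ler_norm _)) ?ltrDl//=.
apply: le_lt_trans (L2norm_le_dist g h) _.
by apply: ler_ltD gh1; exact: ler_norm.
Qed.

Lemma L2_continuous_measurable (F : L2 a -> R) :
  continuous F -> measurable_fun setT F.
Proof.
move=> cF; apply: (measurability _ (RGenOpens.measurableE R)).
move=> _ [_ [u [v ->] <-]]; rewrite setTI; apply: sub_sigma_algebra.
by apply: open_comp => [g _|]; [exact: cF|exact: itv_open].
Qed.

End L2Measurability.

(** * The posterior *)

Section DataMisfit.
Context {R : realType} {a : R} {m : nat}.
Variables (T : L2 a -> 'cV[R]_m) (S : 'M[R]_m) (mu_pr : probability (L2 a) R).
Hypothesis T_lip : forall r, 0 < r -> exists2 K : R, 0 < K &
  forall g1 g2 : L2 a, Num.max (L2norm a g1) (L2norm a g2) < r ->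
    cov_norm S (T g1 - T g2) <= K * L2norm a (g1 \- g2).

Definition misfit (f : 'cV[R]_m) (g : L2 a) : R := cov_norm S (T g - f).

Lemma measurable_misfit f : measurable_fun setT (misfit f).
Proof.
apply: L2_continuous_measurable; apply: locally_lipschitz_continuous => r r0.
have [K K0 TK] := T_lip r0; exists K => // g h gh.
apply: le_trans (cov_norm_dist _ _ _) _.
by rewrite opprB addrA subrK; exact: TK.
Qed.

Lemma posteriorP f mu : is_posterior T S mu_pr f mu <->
  has_density mu_pr mu (normalized mu_pr (gauss (misfit f))).
Proof.
apply: (proportional_densityP mu_pr mu).
  exact: measurable_gauss (measurable_misfit f).
exact: gauss_unit.
Qed.

Lemma posterior_exists_unique f : exists2 mu : probability (L2 a) R,
  is_posterior T S mu_pr f mu &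
  forall mu' : probability (L2 a) R, is_posterior T S mu_pr f mu' ->
    forall A, measurable A -> mu' A = mu A.
Proof.
have [mu muf] := normalized_probability mu_pr
  (measurable_gauss (measurable_misfit f)) (gauss_unit (misfit f)).
exists mu; first exact/posteriorP.
by move=> mu' /posteriorP mu'f A mA; rewrite mu'f// muf.
Qed.

(** The lower bound on the evidence is expressed through the misfit at zero
    data, whose distance to the misfit at f is at most the norm of f. *)
Lemma posterior_hellinger_lipschitz r : 0 < r ->
  exists2 C : R, 0 < C & forall f f' : 'cV[R]_m,
    Num.max (cov_norm S f) (cov_norm S f') < r ->
    forall mu mu' : probability (L2 a) R,
      is_posterior T S mu_pr f mu -> is_posterior T S mu_pr f' mu' ->
      forall ref : {sigma_finite_measure set (L2 a) -> \bar R},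
        mu `<< ref ->
        (hellinger ref mu mu' <= (C * cov_norm S (f - f'))%:E)%E.
Proof.
move=> r0.
pose Z0 := evidence mu_pr (fun g => expR (- misfit 0 g ^+ 2)).
have Z0_gt0 : 0 < Z0.
  apply: evidence_gt0; last first.
    by move=> g; rewrite expR_gt0 -expR0 ler_expR oppr_le0 sqr_ge0.
  apply: (@measurableT_comp _ _ _ _ _ _ expR _
    (fun g => - misfit 0 g ^+ 2)) => //.
  by apply: measurable_funN; apply: measurable_funX; exact: measurable_misfit.
pose b := Num.sqrt (expR (- r ^+ 2) * Z0).
have b0 : 0 < b by rewrite sqrtr_gt0 mulr_gt0// expR_gt0.
have bZ f : cov_norm S f < r -> b ^+ 2 <= evidence mu_pr (gauss (misfit f)).
  move=> fr; rewrite sqr_sqrtr ?mulr_ge0 ?expR_ge0 ?(ltW Z0_gt0)//.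
  apply: evidence_lower_bound; [exact: measurable_misfit..|] => g.
  rewrite cov_norm_ge0 /= /misfit subr0.
  apply: le_trans (cov_normD _ _ _) _.
  by rewrite cov_normN lerD2l ltW.
exists (b^-1 + b^-1 ^+ 3); first by rewrite addr_gt0 ?exprn_gt0 ?invr_gt0.
move=> f f' ff'r mu mu' /posteriorP muf /posteriorP mu'f' ref muref.
have /andP[fr f'r] : (cov_norm S f < r) && (cov_norm S f' < r).
  by rewrite -gt_max.
apply: (hellinger_gauss _ _ _ _ _ b0 (bZ _ fr) (bZ _ f'r) muf mu'f' muref).
- exact: measurable_misfit.
- exact: measurable_misfit.
- by move=> g; exact: cov_norm_ge0.
- by move=> g; exact: cov_norm_ge0.
move=> g; rewrite -(cov_normN _ (f - f')) opprB.
apply: le_trans (cov_norm_dist _ _ _) _.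
by rewrite opprB addrC addrA subrK.
Qed.

End DataMisfit.

Theorem theorem4p3 (R : realType) (a kstar : R) (rad : R -> R) (m : nat)
    (lam : R -> 'I_m -> nat -> R) (x : R -> 'I_m -> R * R)
    (Sigma : nat -> R -> 'M[R]_m) (mu_pr : probability (L2 a) R)
    (a_gt0 : 0 < a) (m_gt0 : (0 < m)%N)
    (kstar_gt0 : 0 < kstar) (kstar_rad : 0 < kstar * rad kstar < 1)
    (Omega0_disc : forall k, wavenumbers a kstar k ->
      compactly_contained (Omega0 a) (disc (rad k)))
    (x_arc : forall k j, wavenumbers a kstar k ->
      boundary_arc (rad k) j (x k j))
    (lam_choice : admissible_lambda a kstar rad lam \/
                  explicit_lambda a kstar rad lam)
    (Sigma_posdef : forall l k, l = 1%N \/ l = 2%N -> wavenumbers a kstar k ->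
      posdefmx (Sigma l k))
    (mu_pr_gaussian : gaussian_measure mu_pr)
    (l : nat) (k : R) (l12 : l = 1%N \/ l = 2%N)
    (kN : wavenumbers a kstar k) :
  let S := Sigma l k in
  let T := @forward R a m k (x k) (fun j => source (rad k) (lam k j l) j) in
  (forall delta, 0 < delta -> exists M : R, forall g : L2 a,
    cov_norm S (T g) <= expR (delta * L2norm a g ^+ 2 + M)) ->
  (forall r, 0 < r -> exists2 K : R, 0 < K & forall g1 g2 : L2 a,
    Num.max (L2norm a g1) (L2norm a g2) < r ->
    cov_norm S (T g1 - T g2) <= K * L2norm a (g1 \- g2)) ->
  (forall f : 'cV[R]_m, exists2 mu : probability (L2 a) R,
    is_posterior T S mu_pr f mu &
    forall mu' : probability (L2 a) R, is_posterior T S mu_pr f mu' ->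
      forall A, measurable A -> mu' A = mu A) /\
  (forall r, 0 < r -> exists2 C : R, 0 < C & forall f f' : 'cV[R]_m,
    Num.max (cov_norm S f) (cov_norm S f') < r ->
    forall mu mu' : probability (L2 a) R,
      is_posterior T S mu_pr f mu -> is_posterior T S mu_pr f' mu' ->
      forall ref : {sigma_finite_measure set (L2 a) -> \bar R},
        mu `<< ref -> mu' `<< ref ->
        (hellinger ref mu mu' <= (C * cov_norm S (f - f'))%:E)%E).
Proof.
move=> S T _ T_lip; split.
  exact: posterior_exists_unique.
move=> r /(posterior_hellinger_lipschitz mu_pr T_lip)[C C0 HC].
by exists C => // f f' ff'r mu mu' muf mu'f' ref muref _; exact: HC muref.
Qed.
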